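(* Let $(G,u)$ be a dimension group with order unit and let $\tau$ be a faithful trace of $G$. Then $\tau$ is good if and only if for every nonzero order ideal $I$ of $G$ having its own order unit $w$, both $\tau(I)=\tau(G)$ and $\tau|_I$ is order unit good (as a trace of $(I,w)$).
   Context: A partially ordered abelian group $G$ with positive cone $G^+$ is unperforated if $ng\in G^+$ for some integer $n\ge 1$ implies $g\in G^+$. A dimension group is a directed unperforated partially ordered abelian group with the Riesz interpolation property. An order unit is $u\in G^+$ such that for every $g\in G$ there is a positive integer $K$ with $-Ku\le g\le Ku$. An order ideal is a convex directed subgroup; it ''has its own order unit $w$'' if $w\in I$ is an order unit of $I$ in the relative ordering. A trace is a nonzero positive group homomorphism $\tau:G\to\mathbb R$; it is faithful if $\ker\tau\cap G^+=\{0\}$. A trace $\tau$ of $G$ is good if for every $b\in G^+$ and every $a'\in G$ with $0\le\tau(a')\le\tau(b)$ there is $a\in G$ with $0\le a\le b$ and $\tau(a)=\tau(a')$. It is order unit good if this holds for all order units $b$ of $G$ (rather than all $b\in G^+$). *)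

(* Defs.v *)
From HB Require Import structures.
From mathcomp Require Import all_boot all_order all_algebra.
From mathcomp Require Import boolp classical_sets reals.

Set Implicit Arguments.
Unset Strict Implicit.
Unset Printing Implicit Defensive.

Import Order.TTheory GRing.Theory Num.Theory.

Local Open Scope classical_set_scope.
Local Open Scope ring_scope.

(* A [porderZmodType] is an abelian group carrying a partial order, with no
   compatibility between the two; translation invariance is therefore stated
   separately.  The positive cone of [G] is then [{g | 0 <= g}]. *)
Definition translation_invariant (G : porderZmodType) : Prop :=
  forall x y z : G, x <= y -> x + z <= y + z.

Definition directed (G : porderZmodType) : Prop :=
  forall x y : G, exists z : G, x <= z /\ y <= z.

Definition unperforated (G : porderZmodType) : Prop :=
  forall (n : nat) (g : G), (1 <= n)%N -> 0 <= g *+ n -> 0 <= g.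

Definition riesz_interpolation (G : porderZmodType) : Prop :=
  forall a1 a2 b1 b2 : G,
    a1 <= b1 -> a1 <= b2 -> a2 <= b1 -> a2 <= b2 ->
    exists c : G, [/\ a1 <= c, a2 <= c, c <= b1 & c <= b2].

Definition dimension_group (G : porderZmodType) : Prop :=
  [/\ translation_invariant G, directed G, unperforated G
    & riesz_interpolation G].

Definition order_unit (G : porderZmodType) (u : G) : Prop :=
  0 <= u /\
  forall g : G, exists K : nat, (0 < K)%N /\ - (u *+ K) <= g <= u *+ K.

(* A subgroup of [G] as a partially ordered abelian group in its own right,
   for the relative ordering. *)
Definition subgroup_of (G : porderZmodType) (I : zmodClosed G) : Type :=
  {x : G | x \in I}.

Section SubgroupInstances.
Variables (G : porderZmodType) (I : zmodClosed G).

HB.instance Definition _ := SubChoice.on (subgroup_of I).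
HB.instance Definition _ := [SubChoice_isSubZmodule of subgroup_of I by <:].
HB.instance Definition _ :=
  [SubChoice_isSubPOrder of subgroup_of I by <: with ring_display].

End SubgroupInstances.

Definition convex (G : porderZmodType) (I : zmodClosed G) : Prop :=
  forall x y z : G, x \in I -> z \in I -> x <= y -> y <= z -> y \in I.

Definition order_ideal (G : porderZmodType) (I : zmodClosed G) : Prop :=
  convex I /\ directed (subgroup_of I).

Definition trace (R : realType) (G : porderZmodType)
    (tau : {additive G -> R}) : Prop :=
  (forall g : G, 0 <= g -> 0 <= tau g) /\ (exists g : G, tau g != 0).

Definition faithful (R : realType) (G : porderZmodType)
    (tau : {additive G -> R}) : Prop :=
  [set g : G | tau g = 0] `&` [set g : G | 0 <= g] = [set 0].

Definition good (R : realType) (G : porderZmodType)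
    (tau : {additive G -> R}) : Prop :=
  forall b a' : G, 0 <= b -> 0 <= tau a' <= tau b ->
    exists a : G, 0 <= a <= b /\ tau a = tau a'.

Definition order_unit_good (R : realType) (G : porderZmodType)
    (tau : {additive G -> R}) : Prop :=
  forall b a' : G, order_unit b -> 0 <= tau a' <= tau b ->
    exists a : G, 0 <= a <= b /\ tau a = tau a'.

Definition restriction (R : realType) (G : porderZmodType)
    (tau : {additive G -> R}) (I : zmodClosed G) :
    {additive subgroup_of I -> R} :=
  tau \o (val : subgroup_of I -> G).

(* Main.v *)
(** Goodness on the interval [[0, b]] only involves the order ideal
    [{x | - K b <= x <= K b for some K}] generated by [b], of which [b] is an
    order unit. Conversely a faithful trace is positive at an order unit [w] of
    a nonzero order ideal, so every value of a good trace is, up to sign, the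
    value at an element of some [[0, n w]], which lies in the ideal by
    convexity. *)
Require Import Defs.
From HB Require Import structures.
From mathcomp Require Import all_boot all_order all_algebra.
From mathcomp Require Import boolp classical_sets reals.

Set Implicit Arguments.
Unset Strict Implicit.
Unset Printing Implicit Defensive.

Import Order.TTheory GRing.Theory Num.Theory.

Local Open Scope classical_set_scope.
Local Open Scope ring_scope.

Section TranslationInvariant.
Variables (G : porderZmodType) (tiG : translation_invariant G).
Implicit Types x y b : G.

Lemma ti_leD x y z t : x <= y -> z <= t -> x + z <= y + t.
Proof.
move=> xy zt; apply: le_trans (tiG z xy) _.
by rewrite ![y + _]addrC; exact: tiG.
Qed.

(** Translation by [- x - y] carries [x <= y] to the claim. *)
Lemma ti_leN x y : x <= y -> - y <= - x.
Proof. by move=> /(tiG (- x - y)); rewrite addrA subrr add0r addrCA subrr addr0. Qed.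

Lemma ti_mulrn_ge0 b n : 0 <= b -> 0 <= b *+ n.
Proof.
move=> b0; elim: n => [|n IHn]; first by rewrite mulr0n.
by rewrite mulrS -[0]addr0; exact: ti_leD.
Qed.

Lemma ti_lerMn2l b m n : 0 <= b -> (m <= n)%N -> b *+ m <= b *+ n.
Proof.
move=> b0 mn; rewrite -(subnKC mn) mulrnDr -[leLHS]addr0.
by apply: ti_leD => //; exact: ti_mulrn_ge0.
Qed.

End TranslationInvariant.

(* The conditions on [G] and [b] are arguments so that the closure instance
   below can be inferred from the predicate. *)
Definition principal_ideal (G : porderZmodType) (b : G)
    of translation_invariant G & 0 <= b : {pred G} :=
  [pred x | `[< exists K : nat, - (b *+ K) <= x <= b *+ K >]].

Section PrincipalIdeal.
Variables (G : porderZmodType) (tiG : translation_invariant G).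
Variables (b : G) (b0 : 0 <= b).

Local Notation J := (principal_ideal tiG b0).

Lemma principal_idealP x :
  reflect (exists K : nat, - (b *+ K) <= x <= b *+ K) (x \in J).
Proof. exact: asboolP. Qed.

Lemma principal_ideal_zmod_closed : zmod_closed J.
Proof.
split=> [|x y /principal_idealP[K /andP[Kx xK]] /principal_idealP[L /andP[Ly yL]]].
  by apply/principal_idealP; exists 0%N; rewrite mulr0n oppr0 lexx.
apply/principal_idealP; exists (K + L)%N; rewrite mulrnDr opprD.
(* Negating the two bounds on [y] exchanges their roles: the upper one bounds [- y] from below, the
   lower one from above. *)
apply/andP; split; apply: ti_leD => //; first exact: ti_leN.
by rewrite -[b *+ L]opprK; exact: ti_leN.
Qed.

HB.instance Definition _ :=
  GRing.isZmodClosed.Build G J principal_ideal_zmod_closed.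

Definition principal_ideal_zmod : zmodClosed G := J.

Lemma mem_principal_ideal_mulrn n : b *+ n \in J.
Proof.
apply/principal_idealP; exists n; rewrite lexx andbT.
apply: (@le_trans _ _ 0); last exact: ti_mulrn_ge0.
by rewrite -oppr0; apply: ti_leN => //; exact: ti_mulrn_ge0.
Qed.

Lemma mem_principal_ideal : b \in J.
Proof. exact: (mem_principal_ideal_mulrn 1). Qed.

Lemma principal_ideal_order_ideal : order_ideal principal_ideal_zmod.
Proof.
split=> [x y z /principal_idealP[K /andP[Kx _]] /principal_idealP[L /andP[_ zL]]
        xy yz|x y].
  apply/principal_idealP; exists (maxn K L); apply/andP; split.
    apply: le_trans (le_trans Kx xy); apply: ti_leN => //.
    by apply: ti_lerMn2l => //; exact: leq_maxl.
  apply: le_trans (le_trans yz zL) _.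
  by apply: ti_lerMn2l => //; exact: leq_maxr.
have /principal_idealP[K /andP[_ xK]] := valP x.
have /principal_idealP[L /andP[_ yL]] := valP y.
(* The larger of the two multiples of [b] dominates both elements and itself lies in the ideal. *)
exists (Sub (b *+ maxn K L) (mem_principal_ideal_mulrn _)).
rewrite -!Order.le_val !SubK; split.
  by apply: le_trans xK _; apply: ti_lerMn2l => //; exact: leq_maxl.
by apply: le_trans yL _; apply: ti_lerMn2l => //; exact: leq_maxr.
Qed.

Lemma principal_ideal_order_unit :
  order_unit (Sub b mem_principal_ideal : subgroup_of principal_ideal_zmod).
Proof.
split=> [|g]; first exact: b0.
have /principal_idealP[K /andP[Kg gK]] := valP g.
(* The membership bound [K] may be [0], while an order unit requires a positive multiple. *)
exists K.+1; split=> //; rewrite -!Order.le_val (raddfN val) !(raddfMn val).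
apply/andP; split.
  by apply: le_trans Kg; apply: ti_leN => //; apply: ti_lerMn2l.
by apply: le_trans gK _; apply: ti_lerMn2l.
Qed.

End PrincipalIdeal.

(** Multiples of [w = 0] would squeeze every element between [0] and [0]. *)
Lemma order_unit_neq0 (G : porderZmodType) (w x : G) :
  order_unit w -> x != 0 -> w != 0.
Proof.
move=> [_ /(_ x)[K [_ /andP[Kx xK]]]]; apply: contra_neq => w0.
by apply/le_anti; move: Kx xK; rewrite w0 mul0rn oppr0 => -> ->.
Qed.

Section Goodness.
Variables (R : realType) (G : porderZmodType) (tau : {additive G -> R}).

Lemma faithful_gt0 (w : G) :
  trace tau -> faithful tau -> 0 <= w -> w != 0 -> 0 < tau w.
Proof.
move=> [tau_ge0 _] ftau w0 wN0; rewrite lt_def tau_ge0 // andbT.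
apply: contra_neq wN0 => tauw0.
by have : [set 0] w by rewrite -ftau; split.
Qed.

Lemma good_image_order_ideal (I : zmodClosed G) (w : G) :
  translation_invariant G -> good tau -> convex I ->
  w \in I -> 0 <= w -> 0 < tau w -> tau @` [set x | x \in I] = range tau.
Proof.
move=> tiG gtau cI wI w0 tauw0; apply/seteqP; split=> [_ [x _ <-]|_ [g _ <-]].
  by exists x.
(* Goodness only reaches nonnegative values, so these come first; negative ones follow by passing to
   [- g]. *)
have nonneg h : 0 <= tau h -> exists2 a, a \in I & tau a = tau h.
  move=> tauh0; have [n hn] : exists n, tau h <= tau (w *+ n).
    (* Since [tau w] is positive, the Archimedean property yields a multiple of [w] whose trace
       dominates [tau h]. *)
    exists (Num.bound (tau h / tau w)); rewrite raddfMn -mulr_natl.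
    rewrite -ler_pdivrMr //; apply: ltW.
    by apply: archi_boundP; apply: divr_ge0 => //; exact: ltW.
  have [|a [/andP[a0 an] <-]] := gtau (w *+ n) h (ti_mulrn_ge0 tiG n w0).
    by rewrite tauh0.
  by exists a => //; apply: cI a0 an; [exact: rpred0|exact: rpredMn].
have [/nonneg[a aI <-]|/ltW tau_le0] := leP 0 (tau g); first by exists a.
have [|a aI tau_a] := nonneg (- g); first by rewrite raddfN oppr_ge0.
by exists (- a); [exact: rpredNr|rewrite raddfN tau_a raddfN opprK].
Qed.

(** The element that goodness in [G] provides lies between [0] and [b], hence in [I] by
    convexity. *)
Lemma good_restriction (I : zmodClosed G) :
  good tau -> convex I -> order_unit_good (restriction tau I).
Proof.
move=> gtau cI b a' [b0 _] tau_a'.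
have b0' : 0 <= val b by move: b0; rewrite -Order.le_val (raddf0 val).
have [a [/andP[a0 ab] tau_a]] := gtau (val b) (val a') b0' tau_a'.
have aI : a \in I by apply: cI a0 ab; [exact: rpred0|exact: valP].
by exists (Sub a aI); split=> [|//]; apply/andP.
Qed.

End Goodness.

Theorem proposition1p1 (R : realType) (G : porderZmodType) (u : G)
    (tau : {additive G -> R})
    (hG : dimension_group G) (hu : order_unit u)
    (htau : trace tau) (hfaithful : faithful tau) :
  good tau <->
  (forall (I : zmodClosed G), order_ideal I -> (exists2 x : G, x \in I & x != 0) ->
   forall w : subgroup_of I, order_unit w ->
     tau @` [set x | x \in I] = range tau /\
     order_unit_good (restriction tau I)).
Proof.
have [tiG _ _ _] := hG.
split=> [gtau I [cI _] [x xI xN0] w wu|tauI b a' b0 tau_a'].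
  split; last exact: good_restriction.
  have w0 : 0 <= val w by case: wu => + _; rewrite -Order.le_val (raddf0 val).
  (* The nonzero element [x] of [I] rules out a zero order unit. *)
  have wN0 : val w != 0.
    have xN0' : (Sub x xI : subgroup_of I) != 0.
      by apply: contra_neq xN0 => /(congr1 val).
    by apply: contra_neq (order_unit_neq0 wu xN0') => ?; exact: val_inj.
  apply: (good_image_order_ideal (w := val w)) => //; first exact: valP.
  exact: faithful_gt0.
(* The assumption covers nonzero ideals only. For [b = 0] the trace of [a'] is squeezed to [0], and
   [a = 0] serves. *)
have [b_eq0|bN0] := eqVneq b 0.
  exists 0; rewrite lexx b0 raddf0; split=> //.
  by apply/esym/le_anti; move: tau_a'; rewrite b_eq0 raddf0 andbC.
have bu := principal_ideal_order_unit tiG b0.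
have [|tau_im ougood] := tauI _ (principal_ideal_order_ideal tiG b0) _ _ bu.
  by exists b => //; exact: mem_principal_ideal.
(* The element [a'] may lie outside the ideal of [b]; equality of the images replaces it by some [c]
   inside with the same trace. *)
have : range tau (tau a') by exists a'.
rewrite -tau_im => -[c cI tau_c].
have [|a [/andP[a0 ab] tau_a]] := ougood _ (Sub c cI) bu.
  by rewrite /restriction /= tau_c.
exists (val a); split; first exact/andP.
by rewrite -tau_c; exact: tau_a.
Qed.
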